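(* Cut-free completeness of $\mathbf{G3PDL}^{\infty}$: if a sequent $\Gamma\Rightarrow\Delta$ is valid, then it has a $\mathbf{G3PDL}^{\infty}$ proof containing no instance of the (Cut) rule.
   Context: PDL syntax: with countably many atomic propositions $p$ and atomic programs $a$, formulas and programs are given mutually by $\varphi,\psi ::= \bot \mid p \mid \varphi\wedge\psi \mid \varphi\vee\psi \mid \varphi\rightarrow\psi \mid [\alpha]\varphi$ and $\alpha,\beta ::= a \mid \alpha;\beta \mid \alpha\cup\beta \mid \varphi? \mid \alpha^{*}$, with the standard Kripke semantics: a model $\mathfrak m=(S,I)$ gives $I(p)\subseteq S$, $I(a)\subseteq S\times S$; $;$ is relational composition, $\cup$ union, $[\![\varphi?]\!]$ the identity on $[\![\varphi]\!]$, $[\![\alpha^*]\!]$ the reflexive–transitive closure of $[\![\alpha]\!]$, and $s\in[\![[\alpha]\varphi]\!]$ iff every $\alpha$-successor of $s$ is in $[\![\varphi]\!]$. Labelled sequents: relational atoms $x\xrightarrow{a}y$ and labelled formulas $x:\varphi$ over a countable set of labels; a sequent $\Gamma\Rightarrow\Delta$ has finite sets $\Gamma,\Delta$ of these. Given a valuation $v$ from labels to states, $x\xrightarrow{a}y$ holds iff $(v(x),v(y))\in I(a)$, $x:\varphi$ holds iff $v(x)\in[\![\varphi]\!]$, and the sequent holds iff whenever all of $\Gamma$ hold some member of $\Delta$ holds; it is valid if it holds for all models and valuations. Rules of $\mathbf{G3PDL}^{\infty}$ (premises / conclusion; ''$A,\Gamma$'' means $\{A\}\cup\Gamma$): (Ax)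 $A\Rightarrow A$; ($\bot$) $x:\bot\Rightarrow$; (WL) $\Gamma\Rightarrow\Delta$ / $A,\Gamma\Rightarrow\Delta$; (WR) $\Gamma\Rightarrow\Delta$ / $\Gamma\Rightarrow\Delta,A$; ($\wedge$L) $x:\varphi,x:\psi,\Gamma\Rightarrow\Delta$ / $x:\varphi\wedge\psi,\Gamma\Rightarrow\Delta$; ($\wedge$R) $\Gamma\Rightarrow\Delta,x:\varphi$ and $\Gamma\Rightarrow\Delta,x:\psi$ / $\Gamma\Rightarrow\Delta,x:\varphi\wedge\psi$; ($\vee$L) $x:\varphi,\Gamma\Rightarrow\Delta$ and $x:\psi,\Gamma\Rightarrow\Delta$ / $x:\varphi\vee\psi,\Gamma\Rightarrow\Delta$; ($\vee$R) $\Gamma\Rightarrow\Delta,x:\varphi,x:\psi$ / $\Gamma\Rightarrow\Delta,x:\varphi\vee\psi$; ($\rightarrow$L) $\Gamma\Rightarrow\Delta,x:\varphi$ and $x:\psi,\Gamma\Rightarrow\Delta$ / $x:\varphi\rightarrow\psi,\Gamma\Rightarrow\Delta$; ($\rightarrow$R) $x:\varphi,\Gamma\Rightarrow\Delta,x:\psi$ / $\Gamma\Rightarrow\Delta,x:\varphi\rightarrow\psi$; ($\Box$L) $y:\varphi,\Gamma\Rightarrow\Delta$ / $x:[a]\varphi,x\xrightarrow{a}y,\Gamma\Rightarrow\Delta$; ($\Box$R) $x\xrightarrow{a}y,\Gamma\Rightarrow\Delta,y:\varphi$ / $\Gamma\Rightarrow\Delta,x:[a]\varphi$ with $y$ fresh;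 (;L/R) replace $x:[\alpha;\beta]\varphi$ by $x:[\alpha][\beta]\varphi$ on the same side; ($\cup$L) $x:[\alpha]\varphi,x:[\beta]\varphi,\Gamma\Rightarrow\Delta$ / $x:[\alpha\cup\beta]\varphi,\Gamma\Rightarrow\Delta$; ($\cup$R) $\Gamma\Rightarrow\Delta,x:[\alpha]\varphi$ and $\Gamma\Rightarrow\Delta,x:[\beta]\varphi$ / $\Gamma\Rightarrow\Delta,x:[\alpha\cup\beta]\varphi$; (?L) $\Gamma\Rightarrow\Delta,x:\varphi$ and $x:\psi,\Gamma\Rightarrow\Delta$ / $x:[\varphi?]\psi,\Gamma\Rightarrow\Delta$; (?R) $x:\varphi,\Gamma\Rightarrow\Delta,x:\psi$ / $\Gamma\Rightarrow\Delta,x:[\varphi?]\psi$; ($*$L) $x:\varphi,x:[\alpha][\alpha^*]\varphi,\Gamma\Rightarrow\Delta$ / $x:[\alpha^*]\varphi,\Gamma\Rightarrow\Delta$; ($*$R) $\Gamma\Rightarrow\Delta,x:\varphi$ and $\Gamma\Rightarrow\Delta,x:[\alpha][\alpha^*]\varphi$ / $\Gamma\Rightarrow\Delta,x:[\alpha^*]\varphi$; (Subst) $\Gamma\Rightarrow\Delta$ / $\Gamma[x/y]\Rightarrow\Delta[x/y]$ (replace $x$ by $y$); (Cut) $\Gamma\Rightarrow\Delta,A$ and $A,\Sigma\Rightarrow\Pi$ / $\Gamma,\Sigma\Rightarrow\Delta,\Pi$. Trace values $\tau=(x,\alpha_1\cdots\alpha_n,\beta,\varphi)$ stand for $x:[\alpha_1]\cdots[\alpha_n][\beta^*]\varphi$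 (spine $\alpha_1\cdots\alpha_n$); $[\gamma]\tau$ prepends $\gamma$ to the spine, $y:\tau$ changes the label. $(\tau,\tau')$ is a trace pair for conclusion $\Gamma\Rightarrow\Delta$ and premise $\Gamma'\Rightarrow\Delta'$ if $\tau\in\Delta,\tau'\in\Delta'$ and: if $\tau$ is principal then $\tau'$ is its immediate ancestor with, for ($\Box$R) $\tau=x:[a]\tau'$, for (?R) $\tau=[\varphi?]\tau'$, for (;R) $\tau=[\alpha;\beta]\tau''$, $\tau'=[\alpha][\beta]\tau''$, for ($\cup$R) $\tau=[\alpha\cup\beta]\tau''$ and $\tau'=[\alpha]\tau''$ resp. $[\beta]\tau''$ in the left resp. right premise, for ($*$R) $\tau=[\alpha^*]\tau'$ (left premise) or $\tau'=[\alpha]\tau$ (right premise); if $\tau$ is not principal then $\tau'=\tau$, except under (Subst) where $\tau$ is $\tau'$ with the substitution applied to its label. It is progressing if $\tau$ is principal with empty spine. A trace $\tau_1,\tau_2,\ldots$ follows a path $s_1,s_2,\ldots$ (a sequence of sequents from the root, each a premise of the previous) if for some $k\ge0$ each $(\tau_i,\tau_{i+1})$ is a trace pair for $(s_{i+k},s_{i+k+1})$. A $\mathbf{G3PDL}^{\infty}$ proof is a possibly infinite derivation tree (no open leaves) in which every infinite path is followed by a trace having infinitely many progressing pairs. *)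

(* Defs.v *)
From HB Require Import structures.
From Stdlib Require Import Relation_Operators.
From mathcomp Require Import all_boot finmap.

Set Implicit Arguments.
Unset Strict Implicit.
Unset Printing Implicit Defensive.

Local Open Scope fset_scope.

(** * Syntax *)

(* Labels, atomic propositions and atomic programs are all drawn from [nat]. *)
Notation label := nat (only parsing).
Notation aprop := nat (only parsing).
Notation aprog := nat (only parsing).

Inductive form : Type :=
| Bot
| Var of aprop
| And of form & form
| Or of form & form
| Imp of form & form
| Box of prog & form
with prog : Type :=
| Atom of aprog
| Seq of prog & prog
| Cup of prog & prog
| Test of form
| Star of prog.

Scheme form_prog_ind := Induction for form Sort Prop
  with prog_form_ind := Induction for prog Sort Prop.
Combined Scheme form_prog_mutind from form_prog_ind, prog_form_ind.

(* The encoding into generic trees only serves to equip formulas and programs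
   with the choice structure required by [{fset _}]. *)
Fixpoint form_enc (f : form) : GenTree.tree nat :=
  match f with
  | Bot => GenTree.Node 0 [::]
  | Var p => GenTree.Leaf p
  | And f g => GenTree.Node 1 [:: form_enc f; form_enc g]
  | Or f g => GenTree.Node 2 [:: form_enc f; form_enc g]
  | Imp f g => GenTree.Node 3 [:: form_enc f; form_enc g]
  | Box a f => GenTree.Node 4 [:: prog_enc a; form_enc f]
  end
with prog_enc (a : prog) : GenTree.tree nat :=
  match a with
  | Atom c => GenTree.Leaf c
  | Seq a b => GenTree.Node 0 [:: prog_enc a; prog_enc b]
  | Cup a b => GenTree.Node 1 [:: prog_enc a; prog_enc b]
  | Test f => GenTree.Node 2 [:: form_enc f]
  | Star a => GenTree.Node 3 [:: prog_enc a]
  end.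

Fixpoint form_dec (t : GenTree.tree nat) : option form :=
  match t with
  | GenTree.Leaf p => Some (Var p)
  | GenTree.Node 0 [::] => Some Bot
  | GenTree.Node 1 [:: t; u] =>
      if (form_dec t, form_dec u) is (Some f, Some g) then Some (And f g)
      else None
  | GenTree.Node 2 [:: t; u] =>
      if (form_dec t, form_dec u) is (Some f, Some g) then Some (Or f g)
      else None
  | GenTree.Node 3 [:: t; u] =>
      if (form_dec t, form_dec u) is (Some f, Some g) then Some (Imp f g)
      else None
  | GenTree.Node 4 [:: t; u] =>
      if (prog_dec t, form_dec u) is (Some a, Some f) then Some (Box a f)
      else None
  | _ => None
  end
with prog_dec (t : GenTree.tree nat) : option prog :=
  match t with
  | GenTree.Leaf c => Some (Atom c)
  | GenTree.Node 0 [:: t; u] =>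
      if (prog_dec t, prog_dec u) is (Some a, Some b) then Some (Seq a b)
      else None
  | GenTree.Node 1 [:: t; u] =>
      if (prog_dec t, prog_dec u) is (Some a, Some b) then Some (Cup a b)
      else None
  | GenTree.Node 2 [:: t] =>
      if form_dec t is Some f then Some (Test f) else None
  | GenTree.Node 3 [:: t] =>
      if prog_dec t is Some a then Some (Star a) else None
  | _ => None
  end.

Lemma form_prog_encK : (forall f, form_dec (form_enc f) = Some f) /\
                       (forall a, prog_dec (prog_enc a) = Some a).
Proof.
by apply: form_prog_mutind => //=
  [f -> g ->|f -> g ->|f -> g ->|a -> f ->|a -> b ->|a -> b ->|f ->|a ->].
Qed.

Lemma form_encK : pcancel form_enc form_dec.
Proof. exact: form_prog_encK.1. Qed.

Lemma prog_encK : pcancel prog_enc prog_dec.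
Proof. exact: form_prog_encK.2. Qed.

HB.instance Definition _ := Countable.copy form (pcan_type form_encK).
HB.instance Definition _ := Countable.copy prog (pcan_type prog_encK).

(** * Kripke semantics *)

Record model : Type := Model {
  state : Type;
  val_prop : aprop -> state -> Prop;
  val_prog : aprog -> state -> state -> Prop
}.

Fixpoint sat (M : model) (f : form) (s : state M) {struct f} : Prop :=
  match f with
  | Bot => False
  | Var p => val_prop p s
  | And f g => sat f s /\ sat g s
  | Or f g => sat f s \/ sat g s
  | Imp f g => sat f s -> sat g s
  | Box a f => forall t, run a s t -> sat f t
  end
with run (M : model) (a : prog) (s t : state M) {struct a} : Prop :=
  match a with
  | Atom c => val_prog c s t
  | Seq a b => exists u, run a s u /\ run b u t
  | Cup a b => run a s t \/ run b s t
  | Test f => s = t /\ sat f s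
  | Star a => clos_refl_trans (state M) (run a) s t
  end.

(** * Labelled sequents *)

(* [Rel x a y] is the relational atom x -a-> y; [Lab x f] is x : f. *)
Inductive assertion : Type :=
| Rel of label & aprog & label
| Lab of label & form.

Definition assertion_enc (A : assertion) :
    (label * aprog * label) + (label * form) :=
  match A with Rel x a y => inl (x, a, y) | Lab x f => inr (x, f) end.

Definition assertion_dec (e : (label * aprog * label) + (label * form)) :=
  match e with inl (x, a, y) => Rel x a y | inr (x, f) => Lab x f end.

Lemma assertion_encK : cancel assertion_enc assertion_dec.
Proof. by case. Qed.

HB.instance Definition _ := Countable.copy assertion (can_type assertion_encK).

Record sequent : Type := Sequent {
  ante : {fset assertion};
  succ : {fset assertion}
}.

Notation "G ⇒ D" := (Sequent G D) (at level 70, no associativity).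

Definition holds (M : model) (v : label -> state M) (A : assertion) : Prop :=
  match A with
  | Rel x a y => val_prog a (v x) (v y)
  | Lab x f => sat f (v x)
  end.

Definition holds_sequent (M : model) (v : label -> state M) (S : sequent) :=
  (forall A, A \in ante S -> holds v A) ->
  exists2 A, A \in succ S & holds v A.

Definition valid (S : sequent) : Prop :=
  forall (M : model) (v : label -> state M), holds_sequent v S.

Definition occurs (z : label) (A : assertion) : bool :=
  match A with
  | Rel x _ y => (z == x) || (z == y)
  | Lab x _ => z == x
  end.

Definition fresh (z : label) (S : sequent) : Prop :=
  forall A, A \in ante S `|` succ S -> ~~ occurs z A.

Definition subst_label (x y z : label) : label := if z == x then y else z.

Definition subst (x y : label) (A : assertion) : assertion :=
  match A with
  | Rel z a w => Rel (subst_label x y z) a (subst_label x y w)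
  | Lab z f => Lab (subst_label x y z) f
  end.

(** * Rule instances *)

(* An instance records its contexts. As contexts are sets, they may contain the
   principal assertion, so contraction is implicit; a conclusion alone does not
   determine the instance. *)
Inductive rule : Type :=
| Ax of assertion
| BotL of label
| WL (G D : {fset assertion}) (A : assertion)
| WR (G D : {fset assertion}) (A : assertion)
| AndL (G D : {fset assertion}) (x : label) (f g : form)
| AndR (G D : {fset assertion}) (x : label) (f g : form)
| OrL (G D : {fset assertion}) (x : label) (f g : form)
| OrR (G D : {fset assertion}) (x : label) (f g : form)
| ImpL (G D : {fset assertion}) (x : label) (f g : form)
| ImpR (G D : {fset assertion}) (x : label) (f g : form)
| BoxL (G D : {fset assertion}) (x y : label) (a : aprog) (f : form)
| BoxR (G D : {fset assertion}) (x y : label) (a : aprog) (f : form)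
| SeqL (G D : {fset assertion}) (x : label) (a b : prog) (f : form)
| SeqR (G D : {fset assertion}) (x : label) (a b : prog) (f : form)
| CupL (G D : {fset assertion}) (x : label) (a b : prog) (f : form)
| CupR (G D : {fset assertion}) (x : label) (a b : prog) (f : form)
| TestL (G D : {fset assertion}) (x : label) (f g : form)
| TestR (G D : {fset assertion}) (x : label) (f g : form)
| StarL (G D : {fset assertion}) (x : label) (a : prog) (f : form)
| StarR (G D : {fset assertion}) (x : label) (a : prog) (f : form)
| Subst (G D : {fset assertion}) (x y : label)
| Cut (G D G' D' : {fset assertion}) (A : assertion).

Definition conclusion (r : rule) : sequent :=
  match r with
  | Ax A => [fset A] ⇒ [fset A]
  | BotL x => [fset Lab x Bot] ⇒ fset0
  | WL G D A => A |` G ⇒ D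
  | WR G D A => G ⇒ A |` D
  | AndL G D x f g => Lab x (And f g) |` G ⇒ D
  | AndR G D x f g => G ⇒ Lab x (And f g) |` D
  | OrL G D x f g => Lab x (Or f g) |` G ⇒ D
  | OrR G D x f g => G ⇒ Lab x (Or f g) |` D
  | ImpL G D x f g => Lab x (Imp f g) |` G ⇒ D
  | ImpR G D x f g => G ⇒ Lab x (Imp f g) |` D
  | BoxL G D x y a f => Lab x (Box (Atom a) f) |` (Rel x a y |` G) ⇒ D
  | BoxR G D x y a f => G ⇒ Lab x (Box (Atom a) f) |` D
  | SeqL G D x a b f => Lab x (Box (Seq a b) f) |` G ⇒ D
  | SeqR G D x a b f => G ⇒ Lab x (Box (Seq a b) f) |` D
  | CupL G D x a b f => Lab x (Box (Cup a b) f) |` G ⇒ D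
  | CupR G D x a b f => G ⇒ Lab x (Box (Cup a b) f) |` D
  | TestL G D x f g => Lab x (Box (Test f) g) |` G ⇒ D
  | TestR G D x f g => G ⇒ Lab x (Box (Test f) g) |` D
  | StarL G D x a f => Lab x (Box (Star a) f) |` G ⇒ D
  | StarR G D x a f => G ⇒ Lab x (Box (Star a) f) |` D
  | Subst G D x y => subst x y @` G ⇒ subst x y @` D
  | Cut G D G' D' A => G `|` G' ⇒ D `|` D'
  end.

Definition premises (r : rule) : seq sequent :=
  match r with
  | Ax _ | BotL _ => [::]
  | WL G D _ | WR G D _ => [:: G ⇒ D]
  | AndL G D x f g => [:: Lab x f |` (Lab x g |` G) ⇒ D]
  | AndR G D x f g => [:: G ⇒ Lab x f |` D; G ⇒ Lab x g |` D]
  | OrL G D x f g => [:: Lab x f |` G ⇒ D; Lab x g |` G ⇒ D]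
  | OrR G D x f g => [:: G ⇒ Lab x f |` (Lab x g |` D)]
  | ImpL G D x f g => [:: G ⇒ Lab x f |` D; Lab x g |` G ⇒ D]
  | ImpR G D x f g => [:: Lab x f |` G ⇒ Lab x g |` D]
  | BoxL G D x y a f => [:: Lab y f |` G ⇒ D]
  | BoxR G D x y a f => [:: Rel x a y |` G ⇒ Lab y f |` D]
  | SeqL G D x a b f => [:: Lab x (Box a (Box b f)) |` G ⇒ D]
  | SeqR G D x a b f => [:: G ⇒ Lab x (Box a (Box b f)) |` D]
  | CupL G D x a b f => [:: Lab x (Box a f) |` (Lab x (Box b f) |` G) ⇒ D]
  | CupR G D x a b f =>
      [:: G ⇒ Lab x (Box a f) |` D; G ⇒ Lab x (Box b f) |` D]
  | TestL G D x f g => [:: G ⇒ Lab x f |` D; Lab x g |` G ⇒ D]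
  | TestR G D x f g => [:: Lab x f |` G ⇒ Lab x g |` D]
  | StarL G D x a f =>
      [:: Lab x f |` (Lab x (Box a (Box (Star a) f)) |` G) ⇒ D]
  | StarR G D x a f =>
      [:: G ⇒ Lab x f |` D; G ⇒ Lab x (Box a (Box (Star a) f)) |` D]
  | Subst G D _ _ => [:: G ⇒ D]
  | Cut G D G' D' A => [:: G ⇒ A |` D; A |` G' ⇒ D']
  end.

Definition side_condition (r : rule) : Prop :=
  match r with
  | BoxR G D x y a f => fresh y (conclusion r)
  | _ => True
  end.

Definition is_cut (r : rule) : bool := if r is Cut _ _ _ _ _ then true else false.

Definition arity (r : rule) : nat := size (premises r).

Definition premise (r : rule) (i : 'I_(arity r)) : sequent :=
  tnth (in_tuple (premises r)) i.

(** * Possibly infinite derivation trees *)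

CoInductive tree : Type := Node (r : rule) (sub : 'I_(arity r) -> tree).

Definition root_rule (t : tree) : rule := let: Node r _ := t in r.

Definition subtree (t : tree) : 'I_(arity (root_rule t)) -> tree :=
  match t with Node _ sub => sub end.

Definition endsequent (t : tree) : sequent := conclusion (root_rule t).

Inductive node (t : tree) : tree -> Prop :=
| node_root : node t t
| node_child u (i : 'I_(arity (root_rule u))) :
    node t u -> node t (subtree i).

(* There are no open leaves: each leaf carries a rule without premises. *)
Definition derivation (t : tree) : Prop :=
  forall u, node t u ->
    side_condition (root_rule u) /\
    forall i : 'I_(arity (root_rule u)), endsequent (subtree i) = premise i.

Definition cut_free (t : tree) : Prop :=
  forall u, node t u -> ~~ is_cut (root_rule u).

(* [dir n] is the premise that the path takes at its [n]-th node. *)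
Definition infinite_path (t : tree) (path : nat -> tree)
    (dir : forall n, 'I_(arity (root_rule (path n)))) : Prop :=
  path 0 = t /\ forall n, path n.+1 = subtree (dir n).

(** * Traces *)

Record trace_value : Type := Trace {
  tlabel : label;
  tspine : seq prog;
  tprog : prog;
  tform : form
}.

Definition assertion_of (tau : trace_value) : assertion :=
  Lab (tlabel tau) (foldr Box (Box (Star (tprog tau)) (tform tau)) (tspine tau)).

Definition tbox (c : prog) (tau : trace_value) : trace_value :=
  Trace (tlabel tau) (c :: tspine tau) (tprog tau) (tform tau).

Definition relabel (y : label) (tau : trace_value) : trace_value :=
  Trace y (tspine tau) (tprog tau) (tform tau).

(* Traces live in succedents, so only right principal assertions matter. *)
Definition principal (r : rule) : option assertion :=
  match r with
  | WR _ _ A => Some A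
  | AndR _ _ x f g => Some (Lab x (And f g))
  | OrR _ _ x f g => Some (Lab x (Or f g))
  | ImpR _ _ x f g => Some (Lab x (Imp f g))
  | BoxR _ _ x _ a f => Some (Lab x (Box (Atom a) f))
  | SeqR _ _ x a b f => Some (Lab x (Box (Seq a b) f))
  | CupR _ _ x a b f => Some (Lab x (Box (Cup a b) f))
  | TestR _ _ x f g => Some (Lab x (Box (Test f) g))
  | StarR _ _ x a f => Some (Lab x (Box (Star a) f))
  | _ => None
  end.

Definition is_principal (r : rule) (tau : trace_value) : bool :=
  principal r == Some (assertion_of tau).

(* [tau'] is the immediate ancestor, in the [i]-th premise, of the principal
   trace value [tau]. The equations alone would leave the label of [tau'] open
   in the case of [BoxR]. A formula introduced by weakening has no ancestor, and
   the right principal formulas of the propositional rules are not the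
   assertions of trace values. *)
Definition ancestor (r : rule) (i : 'I_(arity r)) (tau tau' : trace_value) :
    Prop :=
  match r with
  | BoxR _ _ x y a _ => tlabel tau' = y /\ tau = relabel x (tbox (Atom a) tau')
  | SeqR _ _ _ a b _ =>
      exists tau'', tau = tbox (Seq a b) tau'' /\ tau' = tbox a (tbox b tau'')
  | CupR _ _ _ a b _ =>
      exists tau'', tau = tbox (Cup a b) tau'' /\
        tau' = tbox (if val i == 0 then a else b) tau''
  | TestR _ _ _ f _ => tau = tbox (Test f) tau'
  | StarR _ _ _ a _ =>
      if val i == 0 then tau = tbox (Star a) tau' else tau' = tbox a tau
  | _ => False
  end.

Definition trace_pair (r : rule) (i : 'I_(arity r)) (tau tau' : trace_value) :
    Prop :=
  [/\ assertion_of tau \in succ (conclusion r),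
      assertion_of tau' \in succ (premise i) &
      if is_principal r tau then ancestor i tau tau'
      else if r is Subst _ _ x y
           then tau = relabel (subst_label x y (tlabel tau')) tau'
           else tau' = tau].

Definition progressing_pair (r : rule) (i : 'I_(arity r))
    (tau tau' : trace_value) : Prop :=
  [/\ trace_pair i tau tau', is_principal r tau & tspine tau = [::]].

Definition trace_follows (path : nat -> tree)
    (dir : forall n, 'I_(arity (root_rule (path n))))
    (k : nat) (tau : nat -> trace_value) : Prop :=
  forall n, trace_pair (dir (n + k)%N) (tau n) (tau n.+1).

Definition global_trace_condition (t : tree) : Prop :=
  forall (path : nat -> tree)
         (dir : forall n, 'I_(arity (root_rule (path n)))),
    infinite_path t dir ->
    exists (k : nat) (tau : nat -> trace_value),
      trace_follows dir k tau /\
      forall m, exists2 n, (m <= n)%N &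
        progressing_pair (dir (n + k)%N) (tau n) (tau n.+1).

Definition G3PDL_proof (t : tree) (S : sequent) : Prop :=
  [/\ endsequent t = S, derivation t & global_trace_condition t].

(* Main.v *)
(* A fair cumulative proof search either closes a branch or extends it forever,
   treating every formula infinitely often. If an infinite branch carries no
   infinitely progressing trace, the assertions on its left define a model on
   the labels that refutes it. The point is to falsify [x : [a^*]f] on the right:
   were it true in the model, so would be one of the succedent formulas into
   which the branch decomposes it, forever; following them, and never reaching
   [f] by induction, one obtains a trace that progresses infinitely often. *)

Require Import Defs.
From Stdlib Require Import Relation_Operators Operators_Properties.
From Stdlib Require Import Classical ClassicalEpsilon.
From mathcomp Require Import all_boot finmap.

Set Implicit Arguments.
Unset Strict Implicit.
Unset Printing Implicit Defensive.

Local Open Scope fset_scope.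
Local Open Scope nat_scope.

(** * Proof search *)

Lemma subst_idle (x : label) (G : {fset assertion}) : subst x x @` G = G.
Proof.
have substxx A : subst x x A = A.
  have labxx z : subst_label x x z = z by rewrite /subst_label; case: eqP.
  by case: A => [z a w|z f] /=; rewrite !labxx.
apply/fsetP=> A; apply/imfsetP/idP => [[B /= BG ->]|AG]; first by rewrite substxx.
by exists A; rewrite ?substxx.
Qed.

Definition label_bound (A : assertion) : nat :=
  match A with Rel x _ y => maxn x y | Lab x _ => x end.

Definition fresh_label (S : sequent) : label :=
  (\max_(A <- ante S `|` succ S) label_bound A).+1.

Lemma fresh_labelP S : fresh (fresh_label S) S.
Proof.
move=> A AS; have: label_bound A < fresh_label S.
  by rewrite ltnS (leq_bigmax_seq (F := label_bound)).
case: A {AS} => [x a y|x f] /=; rewrite ?gtn_max; last by move/gtn_eqF->.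
by case/andP=> /gtn_eqF-> /gtn_eqF->.
Qed.

(* Contexts are sets, so a context that contains the principal assertion makes
   the rule cumulative. The identity substitution leaves the sequent as it is. *)
Definition rule_for (t : bool * assertion * label) (S : sequent) : rule :=
  let G := ante S in
  let D := succ S in
  let idle := Subst G D 0 0 in
  match t with
  | (true, Lab x f, y) =>
    if Lab x f \notin G then idle else
    match f with
    | And f g => AndL G D x f g
    | Or f g => OrL G D x f g
    | Imp f g => ImpL G D x f g
    | Box (Atom a) f => if Rel x a y \in G then BoxL G D x y a f else idle
    | Box (Seq a b) f => SeqL G D x a b f
    | Box (Cup a b) f => CupL G D x a b f
    | Box (Test f) g => TestL G D x f g
    | Box (Star a) f => StarL G D x a f
    | _ => idle
    end
  | (false, Lab x f, _) =>
    if Lab x f \notin D then idle else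
    match f with
    | And f g => AndR G D x f g
    | Or f g => OrR G D x f g
    | Imp f g => ImpR G D x f g
    | Box (Atom a) f => BoxR G D x (fresh_label S) a f
    | Box (Seq a b) f => SeqR G D x a b f
    | Box (Cup a b) f => CupR G D x a b f
    | Box (Test f) g => TestR G D x f g
    | Box (Star a) f => StarR G D x a f
    | _ => idle
    end
  | _ => idle
  end.

(** Forgets the task and keeps what the later case analyses need: the contexts are the whole
    sequent, and the principal assertion already lies in it. *)
Variant rule_for_spec (S : sequent) : rule -> Prop :=
| RuleForIdle : rule_for_spec S (Subst (ante S) (succ S) 0 0)
| RuleForAndL x f g of Lab x (And f g) \in ante S :
    rule_for_spec S (AndL (ante S) (succ S) x f g)
| RuleForOrL x f g of Lab x (Or f g) \in ante S :
    rule_for_spec S (OrL (ante S) (succ S) x f g)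
| RuleForImpL x f g of Lab x (Imp f g) \in ante S :
    rule_for_spec S (ImpL (ante S) (succ S) x f g)
| RuleForBoxL x y a f of Lab x (Box (Atom a) f) \in ante S
    & Rel x a y \in ante S :
    rule_for_spec S (BoxL (ante S) (succ S) x y a f)
| RuleForSeqL x a b f of Lab x (Box (Seq a b) f) \in ante S :
    rule_for_spec S (SeqL (ante S) (succ S) x a b f)
| RuleForCupL x a b f of Lab x (Box (Cup a b) f) \in ante S :
    rule_for_spec S (CupL (ante S) (succ S) x a b f)
| RuleForTestL x f g of Lab x (Box (Test f) g) \in ante S :
    rule_for_spec S (TestL (ante S) (succ S) x f g)
| RuleForStarL x a f of Lab x (Box (Star a) f) \in ante S :
    rule_for_spec S (StarL (ante S) (succ S) x a f)
| RuleForAndR x f g of Lab x (And f g) \in succ S :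
    rule_for_spec S (AndR (ante S) (succ S) x f g)
| RuleForOrR x f g of Lab x (Or f g) \in succ S :
    rule_for_spec S (OrR (ante S) (succ S) x f g)
| RuleForImpR x f g of Lab x (Imp f g) \in succ S :
    rule_for_spec S (ImpR (ante S) (succ S) x f g)
| RuleForBoxR x a f of Lab x (Box (Atom a) f) \in succ S :
    rule_for_spec S (BoxR (ante S) (succ S) x (fresh_label S) a f)
| RuleForSeqR x a b f of Lab x (Box (Seq a b) f) \in succ S :
    rule_for_spec S (SeqR (ante S) (succ S) x a b f)
| RuleForCupR x a b f of Lab x (Box (Cup a b) f) \in succ S :
    rule_for_spec S (CupR (ante S) (succ S) x a b f)
| RuleForTestR x f g of Lab x (Box (Test f) g) \in succ S :
    rule_for_spec S (TestR (ante S) (succ S) x f g)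
| RuleForStarR x a f of Lab x (Box (Star a) f) \in succ S :
    rule_for_spec S (StarR (ante S) (succ S) x a f).

Lemma rule_forP t S : rule_for_spec S (rule_for t S).
Proof.
case: t => [[[] [x a y|x f]] z]; rewrite /rule_for; try by constructor.
  case: ifP => [_|/negbFE]; first by constructor.
  case: f => [|p|f g|f g|f g|[a|a b|a b|f|a] g]; try by constructor.
  by case: ifP; constructor.
case: ifP => [_|/negbFE]; first by constructor.
by case: f => [|p|f g|f g|f g|[a|a b|a b|f|a] g]; constructor.
Qed.

Lemma fset1U_id (A : assertion) (G : {fset assertion}) : A \in G -> A |` G = G.
Proof. by move=> AG; apply/fsetUidPr; rewrite fsub1set. Qed.

Lemma rule_for_sound t S :
  [/\ conclusion (rule_for t S) = S, side_condition (rule_for t S)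
    & ~~ is_cut (rule_for t S)].
Proof.
have etaS : (ante S ⇒ succ S) = S by case: S.
by case: rule_forP => *; split;
  rewrite //= ?subst_idle ?fset1U_id //= ?fset1U_id // ?etaS //;
  exact: fresh_labelP.
Qed.

Lemma rule_for_mono t S i : i < arity (rule_for t S) ->
  ante S `<=` ante (nth S (premises (rule_for t S)) i) /\
  succ S `<=` succ (nth S (premises (rule_for t S)) i).
Proof.
rewrite /arity.
by case: i => [|[|i]]; case: rule_forP => //= *; split;
  rewrite ?fsubsetU1 // fsetUA fsubsetUr.
Qed.

(** A task is a side, an assertion and a label; the label only matters for (□L), where it names the
    successor. The default task acts on a relational atom, so it idles. *)
Definition schedule (n : nat) : bool * assertion * label :=
  odflt (true, Rel 0 0 0, 0) (choice.unpickle (head 0 (CodeSeq.decode n))).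

Lemma schedule_fair t n : exists2 m, n <= m & schedule m = t.
Proof.
(* The entries of a list are below its code, so including [n] pushes the stage past [n]. *)
exists (CodeSeq.code [:: choice.pickle t; n]).
  by have /and3P[_ /ltnW] := CodeSeq.ltn_code [:: choice.pickle t; n].
by rewrite /schedule CodeSeq.codeK /= choice.pickleK.
Qed.

(* The rules without premises are (Ax) and (⊥). *)
Definition closed (S : sequent) : Prop :=
  exists r, [/\ premises r = [::], ante (conclusion r) `<=` ante S
              & succ (conclusion r) `<=` succ S].

Definition sequent_size (S : sequent) : nat := #|` ante S| + #|` succ S|.

(** Closed sequents are finished off by weakenings. The decrease in size keeps infinite paths away
    from them. *)
Definition closing_rule (r : rule) : Prop :=
  forall i : 'I_(arity r), closed (premise i) /\
    sequent_size (premise i) < sequent_size (conclusion r).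

(** Any assertion outside the axiom can be weakened away, with a context that really omits it; if
    there is none, the sequent is the conclusion of the axiom itself. *)
Lemma closed_rule S : closed S ->
  exists r, [/\ conclusion r = S, side_condition r, ~~ is_cut r & closing_rule r].
Proof.
case: S => G D [r [r0 /= rG rD]].
have [GE|/fset0Pn[A]] := eqVneq (G `\` ante (conclusion r)) fset0; last first.
  rewrite inE => /andP[Ar AG]; exists (WL (G `\ A) D A).
  split=> //=; first by rewrite fsetD1K.
  case=> [[|[]]] //= lt01; split; last first.
    by rewrite /sequent_size /= fsetD1K // (cardfsD1 A G) AG ltnS.
  by exists r; split=> //=; rewrite fsubsetD1 rG.
have [DE|/fset0Pn[A]] := eqVneq (D `\` succ (conclusion r)) fset0; last first.
  rewrite inE => /andP[Ar AD]; exists (WR G (D `\ A) A).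
  split=> //=; first by rewrite fsetD1K.
  case=> [[|[]]] //= lt01; split; last first.
    by rewrite /sequent_size /= fsetD1K // (cardfsD1 A D) AD addnS ltnS.
  by exists r; split=> //=; rewrite fsubsetD1 rD.
exists r; split.
- have /eqP-> : G == ante (conclusion r).
    by rewrite eqEfsubset rG -fsetD_eq0 GE eqxx.
  have /eqP-> : D == succ (conclusion r).
    by rewrite eqEfsubset rD -fsetD_eq0 DE eqxx.
  by case: (conclusion r).
- by case: r r0 {rG rD GE DE}.
- by case: r r0 {rG rD GE DE}.
- by case=> i lti; exfalso; move: lti; rewrite /arity r0.
Qed.

(** * The search tree *)

Definition search_rule_spec (n : nat) (S : sequent) (r : rule) : Prop :=
  [/\ conclusion r = S, side_condition r, ~~ is_cut r
    & closed S /\ closing_rule r \/ ~ closed S /\ r = rule_for (schedule n) S].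

Lemma search_rule_exists n S : exists r, search_rule_spec n S r.
Proof.
have [cS|ncS] := classic (closed S).
  by have [r [? ? ? ?]] := closed_rule cS; exists r; split=> //; left.
have [? ? ?] := rule_for_sound (schedule n) S.
by exists (rule_for (schedule n) S); split=> //; right.
Qed.

Definition search_rule (n : nat) (S : sequent) : rule :=
  proj1_sig (constructive_indefinite_description _ (search_rule_exists n S)).

Lemma search_ruleP n S : search_rule_spec n S (search_rule n S).
Proof. exact: proj2_sig. Qed.

CoFixpoint search (n : nat) (S : sequent) : tree :=
  Node (fun i : 'I_(arity (search_rule n S)) => search n.+1 (premise i)).

(** [u] is kept abstract because the type of [i] depends on it: [i] is generalised before the
    rewriting. *)
Lemma subtree_search n S u (i : 'I_(arity (root_rule u))) :
  u = search n S -> subtree i = search n.+1 (premise i).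
Proof. by move=> uE; move: i; rewrite uE. Qed.

Lemma endsequent_search n S : endsequent (search n S) = S.
Proof. by case: (search_ruleP n S). Qed.

Lemma node_search n S u :
  node (search n S) u -> exists m S', u = search m S'.
Proof.
elim=> [|{}u i _ [m [S' uE]]]; first by exists n, S.
by exists m.+1, (premise i); apply: subtree_search uE.
Qed.

Lemma derivation_search n S : derivation (search n S).
Proof.
move=> _ /node_search[m [S' ->]]; have [_ sideS' _ _] := search_ruleP m S'.
split=> // i; rewrite (@subtree_search m S') //; exact: endsequent_search.
Qed.

Lemma cut_free_search n S : cut_free (search n S).
Proof.
by move=> _ /node_search[m [S' ->]]; have [_ _ ncut _] := search_ruleP m S'.
Qed.

(** * The countermodel of an infinite branch *)

Section Branch.

Variables (S : nat -> sequent) (task : nat -> bool * assertion * label).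
(* [dir n] is the index of the premise that the branch follows at stage [n]. *)
Variable dir : nat -> nat.
Let rules n := rule_for (task n) (S n).
Hypothesis task_fair : forall t n, exists2 m, n <= m & task m = t.
Hypothesis dirP : forall n, dir n < arity (rules n).
Hypothesis S_next : forall n, S n.+1 = nth (S n) (premises (rules n)) (dir n).
Hypothesis S_open : forall n, ~ closed (S n).

(** The limits of the two sides; by [branch_mono] an assertion that has entered a side never leaves
    it. *)
Let inL A := exists n, A \in ante (S n).
Let inR A := exists n, A \in succ (S n).

Lemma branch_mono n m : n <= m ->
  ante (S n) `<=` ante (S m) /\ succ (S n) `<=` succ (S m).
Proof.
move/subnK <-; elim: (m - n) => [|k [IHl IHr]] //.
have := @rule_for_mono (task (k + n)) (S (k + n)) _ (dirP _).
rewrite -/(rules _) -S_next => -[nextl nextr].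
by split; [apply: fsubset_trans IHl nextl | apply: fsubset_trans IHr nextr].
Qed.

Lemma branch_disjoint A : inL A -> inR A -> False.
Proof.
move=> [n An] [m Am]; apply: (S_open (n := maxn n m)); exists (Ax A).
have [/fsubsetP Sn _] := branch_mono (leq_maxl n m).
have [_ /fsubsetP Sm] := branch_mono (leq_maxr n m).
by split; rewrite //= fsub1set; [apply: Sn | apply: Sm].
Qed.

Lemma branch_noBot x : ~ inL (Lab x Bot).
Proof.
move=> [n An]; apply: (S_open (n := n)); exists (BotL x).
by split; rewrite //= ?fsub1set ?fsub0set.
Qed.

Definition branch_model : model :=
  Model (fun p x => inL (Lab x (Var p))) (fun a x y => inL (Rel x a y)).
Let M := branch_model.


Lemma fire t n : exists m i, [/\ n <= m, rules m = rule_for t (S m),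
  i < arity (rule_for t (S m))
  & S m.+1 = nth (S m) (premises (rule_for t (S m))) i].
Proof.
have [m le_nm taskm] := task_fair t n; exists m, (dir m).
have := dirP m; have := S_next m; rewrite /rules taskm.
by split.
Qed.

Lemma fireL A y n : A \in ante (S n) -> exists m i,
  [/\ A \in ante (S m), n <= m, i < arity (rule_for (true, A, y) (S m))
  & S m.+1 = nth (S m) (premises (rule_for (true, A, y) (S m))) i].
Proof.
move=> An; have [m [i [le_nm _ lti SE]]] := fire (true, A, y) n.
by exists m, i; split=> //; have [/fsubsetP Sn _] := branch_mono le_nm; apply: Sn.
Qed.

Lemma fireR A n : A \in succ (S n) -> exists m i,
  [/\ A \in succ (S m), n <= m, i < arity (rule_for (false, A, 0) (S m))
  & S m.+1 = nth (S m) (premises (rule_for (false, A, 0) (S m))) i].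
Proof.
move=> An; have [m [i [le_nm _ lti SE]]] := fire (false, A, 0) n.
by exists m, i; split=> //; have [_ /fsubsetP Sn] := branch_mono le_nm; apply: Sn.
Qed.

(** * Saturation of the limit sets *)

Lemma inL_And x f g : inL (Lab x (And f g)) -> inL (Lab x f) /\ inL (Lab x g).
Proof.
case=> n /(fireL 0) [m [i [Am _]]]; rewrite /arity /rule_for Am /=.
case: i => [|i] //= _ SE.
by split; exists m.+1; rewrite SE /= !inE eqxx ?orbT.
Qed.

Lemma inL_Or x f g : inL (Lab x (Or f g)) -> inL (Lab x f) \/ inL (Lab x g).
Proof.
case=> n /(fireL 0) [m [i [Am _]]]; rewrite /arity /rule_for Am /=.
by case: i => [|[|i]] //= _ SE; [left|right];
  exists m.+1; rewrite SE /= !inE eqxx ?orbT.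
Qed.

Lemma inL_Imp x f g : inL (Lab x (Imp f g)) -> inR (Lab x f) \/ inL (Lab x g).
Proof.
case=> n /(fireL 0) [m [i [Am _]]]; rewrite /arity /rule_for Am /=.
by case: i => [|[|i]] //= _ SE; [left|right];
  exists m.+1; rewrite SE /= !inE eqxx ?orbT.
Qed.

Lemma inL_Atom x y a f : inL (Lab x (Box (Atom a) f)) -> inL (Rel x a y) ->
  inL (Lab y f).
Proof.
move=> [n1 A1] [n2 A2]; have [/fsubsetP S1 _] := branch_mono (leq_maxl n1 n2).
have [/fsubsetP S2 _] := branch_mono (leq_maxr n1 n2).
(* Firing after both stages ensures that the relational atom is present too; otherwise the task
   would idle. *)
have [m [i [Am le_nm]]] := fireL y (S1 _ A1).
have [/fsubsetP Sm _] := branch_mono le_nm.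
rewrite /arity /rule_for Am (Sm _ (S2 _ A2)) /=.
by case: i => [|i] //= _ SE; exists m.+1; rewrite SE /= !inE eqxx.
Qed.

Lemma inL_Seq x a b f : inL (Lab x (Box (Seq a b) f)) ->
  inL (Lab x (Box a (Box b f))).
Proof.
case=> n /(fireL 0) [m [i [Am _]]]; rewrite /arity /rule_for Am /=.
by case: i => [|i] //= _ SE; exists m.+1; rewrite SE /= !inE eqxx ?orbT.
Qed.

Lemma inL_Cup x a b f : inL (Lab x (Box (Cup a b) f)) ->
  inL (Lab x (Box a f)) /\ inL (Lab x (Box b f)).
Proof.
case=> n /(fireL 0) [m [i [Am _]]]; rewrite /arity /rule_for Am /=.
case: i => [|i] //= _ SE.
by split; exists m.+1; rewrite SE /= !inE eqxx ?orbT.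
Qed.

Lemma inL_Test x f g : inL (Lab x (Box (Test f) g)) ->
  inR (Lab x f) \/ inL (Lab x g).
Proof.
case=> n /(fireL 0) [m [i [Am _]]]; rewrite /arity /rule_for Am /=.
by case: i => [|[|i]] //= _ SE; [left|right];
  exists m.+1; rewrite SE /= !inE eqxx ?orbT.
Qed.

Lemma inL_Star x a f : inL (Lab x (Box (Star a) f)) ->
  inL (Lab x f) /\ inL (Lab x (Box a (Box (Star a) f))).
Proof.
case=> n /(fireL 0) [m [i [Am _]]]; rewrite /arity /rule_for Am /=.
case: i => [|i] //= _ SE.
by split; exists m.+1; rewrite SE /= !inE eqxx ?orbT.
Qed.

Lemma inR_And x f g : inR (Lab x (And f g)) -> inR (Lab x f) \/ inR (Lab x g).
Proof.
case=> n /fireR [m [i [Am _]]]; rewrite /arity /rule_for Am /=.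
by case: i => [|[|i]] //= _ SE; [left|right];
  exists m.+1; rewrite SE /= !inE eqxx ?orbT.
Qed.

Lemma inR_Or x f g : inR (Lab x (Or f g)) -> inR (Lab x f) /\ inR (Lab x g).
Proof.
case=> n /fireR [m [i [Am _]]]; rewrite /arity /rule_for Am /=.
case: i => [|i] //= _ SE.
by split; exists m.+1; rewrite SE /= !inE eqxx ?orbT.
Qed.

Lemma inR_Imp x f g : inR (Lab x (Imp f g)) -> inL (Lab x f) /\ inR (Lab x g).
Proof.
case=> n /fireR [m [i [Am _]]]; rewrite /arity /rule_for Am /=.
case: i => [|i] //= _ SE.
by split; exists m.+1; rewrite SE /= !inE eqxx ?orbT.
Qed.

(** * Tracking boxes on the right *)

(** A functional version of the ancestor relation, on labelled formulas instead of trace values: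
    which star a trace follows is fixed only later. *)
Definition descend (r : rule) (i : nat) (p : label * form) : label * form :=
  if principal r != Some (Lab p.1 p.2) then p else
  match r with
  | BoxR _ _ _ y _ f => (y, f)
  | SeqR _ _ x a b f => (x, Box a (Box b f))
  | CupR _ _ x a b f => (x, Box (if i == 0 then a else b) f)
  | TestR _ _ x _ g => (x, g)
  | StarR _ _ x a f => (x, if i == 0 then f else Box a (Box (Star a) f))
  | _ => p
  end.

(* [j] counts stages from stage [n], where the tracing of [p] starts. *)
Fixpoint track (n : nat) (p : label * form) (j : nat) : label * form :=
  if j is k.+1 then descend (rules (k + n)) (dir (k + n)) (track n p k) else p.

Lemma track_cat n p j k : track n p (k + j) = track (j + n) (track n p j) k.
Proof. by elim: k => //= k ->; rewrite addnA. Qed.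

(* A counterexample to the truth lemma. *)
Definition bad (n : nat) (p : label * form) : Prop :=
  Lab p.1 p.2 \in succ (S n) /\ sat (M := M) p.2 p.1.

(** The lists [s] will become the spines of a trace once [f] is a star formula. *)
Definition bad_path (f : form) (n : nat) (p : label * form) (j : nat) : Prop :=
  forall i, i <= j -> bad (i + n) (track n p i) /\
    exists s, (track n p i).2 = foldr Box f s.

Definition bad_reach (f : form) (n : nat) (p : label * form) : Prop :=
  exists j, bad_path f n p j /\ (track n p j).2 = f.

Lemma bad_path_cat f n p j k : bad_path f n p j ->
  bad_path f (j + n) (track n p j) k -> bad_path f n p (k + j).
Proof.
move=> pathj pathk i lei; have [/pathj//|/ltnW/subnK jE] := leqP i j.
rewrite -jE track_cat -addnA; apply: pathk.
by rewrite -(leq_add2r j) jE.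
Qed.

Lemma bad_path_box a f n p j : bad_path (Box a f) n p j -> bad_path f n p j.
Proof.
move=> pathj i /pathj[badi [s ->]]; split=> //.
by exists (rcons s a); rewrite foldr_rcons.
Qed.

Lemma bad_reach_cat f n p j : bad_path f n p j ->
  bad_reach f (j + n) (track n p j) -> bad_reach f n p.
Proof.
by move=> pathj [k [pathk kE]]; exists (k + j); rewrite track_cat; split=> //;
  apply: bad_path_cat.
Qed.

(** Whatever task made [A] principal on the right, the stage can be analysed as if the task had been
    [(false, A, 0)]. *)
Lemma rule_for_principal t T A : principal (rule_for t T) = Some A ->
  rule_for t T = rule_for (false, A, 0) T /\ A \in succ T.
Proof.
by case: rule_forP => //= > inT [<-]; rewrite /rule_for inT.
Qed.

Lemma bad_wait n x a f (p := (x, Box a f)) : bad n p -> exists j i,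
  let r := rule_for (false, Lab x (Box a f), 0) (S (j + n)) in
  [/\ forall k, k <= j -> track n p k = p /\ bad (k + n) p,
    rules (j + n) = r /\ Lab x (Box a f) \in succ (S (j + n)),
    i < arity r, S (j.+1 + n) = nth (S (j + n)) (premises r) i
  & track n p j.+1 = descend r i p].
Proof.
move=> [pn satp].
have inS j : Lab x (Box a f) \in succ (S (j + n)).
  by have [_ /fsubsetP] := branch_mono (leq_addl j n); apply.
have exj : exists j, principal (rules (j + n)) == Some (Lab x (Box a f)).
  have [m [_ [le_nm rm _ _]]] := fire (false, Lab x (Box a f), 0) n.
  exists (m - n); rewrite subnK // rm /rule_for.
  have := inS (m - n); rewrite subnK // => -> /=.
  by case: (a) => /=.
case: (ex_minnP exj) => j /eqP/rule_for_principal[rj _] jmin.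
have trackE k : k <= j -> track n p k = p.
  elim: k => //= k IH ltij; rewrite IH 1?ltnW // /descend.
  by case: eqP => //= /eqP/jmin; rewrite leqNgt ltij.
exists j, (dir (j + n)); split=> //.
- by move=> k /trackE->; split.
- by have := dirP (j + n); rewrite /rules rj.
- by rewrite addSn S_next /rules rj.
- by rewrite /= trackE // /rules rj.
Qed.

Lemma bad_path_wait f s n x a g j (p := (x, Box a g)) :
  foldr Box f s = Box a g ->
  (forall k, k <= j -> track n p k = p /\ bad (k + n) p) ->
  bad_path f n p j.
Proof. by move=> sE pj k /pj[-> ?]; split=> //; exists s; rewrite sE. Qed.

Lemma bad_path_next f s n p q j : bad_path f n p j -> track n p j.+1 = q ->
  bad (j.+1 + n) q -> q.2 = foldr Box f s -> bad_path f n p j.+1.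
Proof.
move=> pj trackj badj qE k; rewrite leq_eqVlt => /predU1P[->|/pj//].
by rewrite trackj; split=> //; exists s.
Qed.

(** * Boxes, program by program *)

(** The right half does not speak of falsity: it carries badness from the box down to [f] along the
    track. Nothing is assumed about [f], so it applies when [f] is itself a box, as composition and
    iteration require, and it keeps the path from which a trace is read off. *)
Definition box_complete (a : prog) : Prop :=
  (forall f x y, inL (Lab x (Box a f)) -> run (M := M) a x y -> inL (Lab y f)) /\
  (forall f n x, bad n (x, Box a f) -> bad_reach f n (x, Box a f)).

Lemma box_complete_Atom c : box_complete (Atom c).
Proof.
split=> [f x y xf xy|f n x /[dup] badx /bad_wait[j [i]]].
  exact: inL_Atom xf xy.
case=> pj [_ xin]; rewrite /rule_for xin /arity /=.
case: i => [|i] //= _ SE; rewrite /descend eqxx /= => trackj.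
set y := fresh_label _ in SE trackj.
(* (□R) puts the relational atom on the left, which makes the fresh label a successor in the model;
   hence [f] is true there. *)
have bady : bad (j.+1 + n) (y, f).
  split; first by rewrite SE /= !inE eqxx.
  by apply: badx.2; exists (j.+1 + n); rewrite SE /= !inE eqxx.
exists j.+1; rewrite [track _ _ _]trackj; split=> //.
by apply: (@bad_path_next f [::]) trackj bady _ => //;
  apply: (bad_path_wait (s := [:: Atom c])).
Qed.

Lemma box_complete_Seq a b :
  box_complete a -> box_complete b -> box_complete (Seq a b).
Proof.
move=> [La Ra] [Lb Rb].
split=> [f x y xf|f n x /[dup] badx /bad_wait[j [i]]].
  by case=> z [/(La _ _ _ (inL_Seq xf))]; apply: Lb.
case=> pj [_ xin]; rewrite /rule_for xin /arity /=.
case: i => [|i] //= _ SE; rewrite /descend eqxx /= => trackj.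
have bady : bad (j.+1 + n) (x, Box a (Box b f)).
  split=> [|y xy z yz]; first by rewrite SE /= !inE eqxx.
  by apply: badx.2; exists y.
have pathj : bad_path f n (x, Box (Seq a b) f) j.+1.
  apply: (@bad_path_next f [:: a; b]) trackj bady _ => //.
  by apply: (bad_path_wait (s := [:: Seq a b])).
apply: (bad_reach_cat pathj); rewrite [track _ _ _]trackj.
(* [Ra] leads the track to the box of [b], where [Rb] takes over. *)
have [k [pathk kE]] := Ra _ _ _ bady.
apply: (bad_reach_cat (bad_path_box pathk)).
have [] := pathk k (leqnn k); case: track kE => y g /= -> badg _; exact: Rb.
Qed.

Lemma box_complete_Cup a b :
  box_complete a -> box_complete b -> box_complete (Cup a b).
Proof.
move=> [La Ra] [Lb Rb].
split=> [f x y /inL_Cup[xa xb]|f n x /[dup] badx /bad_wait[j [i]]].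
  by case; [apply: La|apply: Lb].
case=> pj [_ xin]; rewrite /rule_for xin /arity => lti SE.
rewrite /descend /= eqxx /= => trackj.
(* Truth of the union box gives truth of both boxes, so badness survives whichever premise the
   branch takes. *)
have bady : bad (j.+1 + n) (x, Box (if i == 0 then a else b) f).
  split=> [|y xy]; last first.
    by apply: badx.2; case: eqP xy; [left|right].
  by case: i lti SE trackj => [|[|i]] //= _ -> _; rewrite !inE eqxx.
have pathj : bad_path f n (x, Box (Cup a b) f) j.+1.
  apply: (@bad_path_next f [:: if i == 0 then a else b]) trackj bady _ => //.
  by apply: (bad_path_wait (s := [:: Cup a b])).
apply: (bad_reach_cat pathj); rewrite [track _ _ _]trackj.
by case: eqP bady => _; [apply: Ra|apply: Rb].
Qed.

Definition form_complete (f : form) : Prop :=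
  (forall x, inL (Lab x f) -> sat (M := M) f x) /\
  (forall x, inR (Lab x f) -> ~ sat (M := M) f x).

Lemma box_complete_Test f : form_complete f -> box_complete (Test f).
Proof.
move=> [Lf Rf]; split.
  by move=> g x y /inL_Test[/Rf nf [_ /nf]|xg [<-]].
move=> g n x /[dup] badx /bad_wait[j [i]].
case=> pj [_ xin]; rewrite /rule_for xin /arity /=.
case: i => [|i] //= _ SE; rewrite /descend eqxx /= => trackj.
have bady : bad (j.+1 + n) (x, g).
  split; first by rewrite SE /= !inE eqxx.
  apply: badx.2; split=> //; apply: Lf.
  by exists (j.+1 + n); rewrite SE /= !inE eqxx.
exists j.+1; rewrite [track _ _ _]trackj; split=> //.
by apply: (@bad_path_next g [::]) trackj bady _ => //;
  apply: (bad_path_wait (s := [:: Test f])).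
Qed.

(** The absence of an infinitely progressing trace, stated for tracks: a principal bare target is a
    progress point. *)
Hypothesis no_star_track : forall n p a f (target := Box (Star a) f),
  (forall j, bad (j + n) (track n p j) /\
     exists s, (track n p j).2 = foldr Box target s) ->
  ~ forall m, exists2 j, m <= j &
      (track n p j).2 = target /\
      principal (rules (j + n)) = Some (Lab (track n p j).1 target).

(** One round of the star. When it becomes principal, the left premise would make [f] bad by
    reflexivity and so reach it. The branch thus takes the right premise, and the hypothesis on [a],
    applied with the target in place of [f], brings the track back to the target. *)
Lemma star_loop a f n x (target := Box (Star a) f) : box_complete a ->
  bad n (x, target) -> ~ bad_reach f n (x, target) -> exists j k,
  [/\ j < k, bad_path target n (x, target) k,
      (track n (x, target) k).2 = target,
      track n (x, target) j = (x, target)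
    & principal (rules (j + n)) = Some (Lab x target)].
Proof.
move=> [_ Ra] badx noreach; have [j [i]] := bad_wait badx.
case=> pj [rj xin]; have := rj; rewrite /rule_for xin /arity /=.
move=> {}rj lti SE; rewrite /descend /= eqxx /= => trackj.
have pathj : bad_path target n (x, target) j.
  by apply: (bad_path_wait (s := [::])).
case: i lti SE trackj => [|[|i]] //= _ SE trackj.
  case: noreach; exists j.+1; rewrite [track _ _ _]trackj; split=> //.
  apply: (@bad_path_next f [::]) trackj _ _ => //.
    exact: (@bad_path_box (Star a)).
  split; first by rewrite SE /= !inE eqxx.
  by apply: badx.2; apply: rt_refl.
have bady : bad (j.+1 + n) (x, Box a target).
  split=> [|y xy z yz]; first by rewrite SE /= !inE eqxx.
  by apply: badx.2; apply: rt_trans yz; apply: rt_step.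
have [k [pathk kE]] := Ra _ _ _ bady.
exists j, (k + j.+1); split.
- by rewrite addnS ltnS leq_addl.
- apply: bad_path_cat; last by rewrite [track _ _ j.+1]trackj.
  exact: (@bad_path_next target [:: a]) trackj bady _.
- by rewrite track_cat [track _ _ j.+1]trackj.
- by case: (pj j (leqnn j)).
- by rewrite rj.
Qed.

Lemma box_complete_Star a : box_complete a -> box_complete (Star a).
Proof.
move=> /[dup] ca [La Ra]; split=> [f x y xf /clos_rt_rt1n_iff xy|f n x badx].
  elim: xy xf => [{}x /inL_Star[]//|{}x z {}y xz _ IH /inL_Star[_ xf]].
  exact/IH/(La _ _ _ xf).
apply: NNPP => noreach; set target := Box (Star a) f in badx noreach *.
(* Rounds can be chained: if [f] were reachable from a return to the target, it would be reachable
   from the start. *)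
have step j : bad_path target n (x, target) j ->
    (track n (x, target) j).2 = target -> exists j' k,
  [/\ j <= j' < k, bad_path target n (x, target) k,
      (track n (x, target) k).2 = target,
      (track n (x, target) j').2 = target
    & principal (rules (j' + n)) = Some (Lab (track n (x, target) j').1 target)].
  move=> pathj jE; have [] := pathj j (leqnn j).
  have [y trackj] : exists y, track n (x, target) j = (y, target).
    by exists (track n (x, target) j).1; rewrite [LHS]surjective_pairing jE.
  rewrite trackj => bady _.
  have [|j' [k [ltjk pathk kE jE' pj]]] := star_loop ca bady.
    move=> reachy; apply: noreach; apply: (bad_reach_cat (bad_path_box pathj)).
    by rewrite trackj.
  exists (j' + j), (k + j); split.
  - by rewrite leq_addl ltn_add2r.
  - by apply: bad_path_cat => //; rewrite trackj.
  - by rewrite track_cat trackj.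
  - by rewrite track_cat trackj jE'.
  - by rewrite -addnA track_cat trackj jE' pj.
have far m : exists2 j, m <= j &
    bad_path target n (x, target) j /\ (track n (x, target) j).2 = target.
  elim: m => [|m [j lemj [pathj jE]]].
    exists 0 => //; split=> // i; rewrite leqn0 => /eqP-> /=.
    by split=> //; exists [::].
  have [j' [k [/andP[lejj ltjk] pathk kE _ _]]] := step j pathj jE.
  by exists k => //; apply: leq_ltn_trans ltjk; apply: leq_trans lejj.
(* The track is a fixed function of the branch, so the arbitrarily long bad paths are pieces of one
   infinite track. *)
apply: (@no_star_track n (x, target) a f) => [j|m].
  by have [k lejk [pathk _]] := far j; apply: pathk.
have [j lemj [pathj jE]] := far m.
have [j' [k [/andP[lejj _] _ _ jE' prin]]] := step j pathj jE.
by exists j' => //; apply: leq_trans lejj.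
Qed.

(** * The truth lemma *)

(** For a box on the right, truth would make it bad; [box_complete] then finds a bad occurrence of
    the formula under the box, against the induction hypothesis. *)
Lemma truth : (forall f, form_complete f) /\ (forall a, box_complete a).
Proof.
apply: form_prog_mutind.
- by split=> [x /branch_noBot|x _].
- by move=> p; split=> // x xR xL; apply: branch_disjoint xL xR.
- move=> f [Lf Rf] g [Lg Rg]; split=> x.
    by case/inL_And=> /Lf ? /Lg ?; split.
  by case/inR_And=> [/Rf ? []|/Rg ? []].
- move=> f [Lf Rf] g [Lg Rg]; split=> x.
    by case/inL_Or=> [/Lf|/Lg]; [left|right].
  by case/inR_Or=> /Rf ? /Rg ? [].
- move=> f [Lf Rf] g [Lg Rg]; split=> x.
    by case/inL_Imp=> [/Rf nf /nf|/Lg sg _].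
  by case/inR_Imp=> /Lf sf /Rg sg /(_ sf).
- move=> a [La Ra] f [Lf Rf]; split=> [x xf y xy|x [n xn] satx].
    exact/Lf/(La _ _ _ xf).
  have [|j [pathj jE]] := Ra f n x; first by split.
  have [[jin jsat] _] := pathj j (leqnn j).
  by rewrite jE in jin jsat; apply: Rf jsat; exists (j + n).
- exact: box_complete_Atom.
- by move=> a ? b ?; apply: box_complete_Seq.
- by move=> a ? b ?; apply: box_complete_Cup.
- exact: box_complete_Test.
- by move=> a ?; apply: box_complete_Star.
Qed.

Lemma branch_not_valid : ~ valid (S 0).
Proof.
have [cf _] := truth.
case/(_ M id) => [[x a y|x f] A0|[x a y|x f] A0 holdsA].
- by exists 0.
- by apply: (cf f).1; exists 0.
- by apply: branch_disjoint holdsA _; exists 0.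
- by apply: (cf f).2 holdsA; exists 0.
Qed.

End Branch.

(** * Tracks as traces *)

Fixpoint box_depth (f : form) : nat :=
  if f is Box _ g then (box_depth g).+1 else 0.

Lemma box_depth_foldr f s : box_depth (foldr Box f s) = size s + box_depth f.
Proof. by elim: s => //= a s ->. Qed.

(** The box depth determines the length of the spine. With the target fixed, a formula has one spine
    only, although nested stars let it be split as a trace value in several ways. *)
Lemma foldr_Box_inj f : injective (foldr Box f).
Proof.
move=> s t /[dup] /(congr1 box_depth); rewrite !box_depth_foldr => /addIn.
by elim: s t => [|a s IH] [|b t] //= [/IH{}IH] [-> /IH->].
Qed.

Lemma foldr_Box_neq f a s : f <> foldr Box (Box a f) s.
Proof.
move/(congr1 box_depth); rewrite box_depth_foldr /= addnS => /eqP.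
by rewrite ltn_eqF // ltnS leq_addl.
Qed.

(** Both ends share the target, so injectivity recovers the new spine from the formula that
    [descend] yields. *)
Lemma trace_pair_descend T r (i : 'I_(arity r)) x s y t a f
    (target := Box (Star a) f) : rule_for_spec T r ->
  Lab x (foldr Box target s) \in succ (conclusion r) ->
  Lab y (foldr Box target t) \in succ (premise i) ->
  descend r i (x, foldr Box target s) = (y, foldr Box target t) ->
  trace_pair i (Trace x s a f) (Trace y t a f).
Proof.
move=> rT xin yin step; split=> //.
have idle : (x, foldr Box target s) = (y, foldr Box target t) ->
    Trace y t a f = Trace x s a f by case=> -> /foldr_Box_inj->.
move: rT i step {xin yin}; rewrite /is_principal /descend.
case=> [|x' g h _|x' g h _|x' g h _|x' y' b g _ _|x' b c g _|x' b c g _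
  |x' g h _|x' b g _|x' g h _|x' g h _|x' g h _|x' b g _|x' b c g _|x' b c g _
  |x' g h _|x' b g _] i; rewrite /assertion_of /=; do ?exact: idle.
- by move/idle=> <-; rewrite /relabel /subst_label /=; case: eqP => // ->.
- by case: eqP => [[_]|_ /idle//]; case: s {idle}.
- by case: eqP => [[_]|_ /idle//]; case: s {idle}.
- by case: eqP => [[_]|_ /idle//]; case: s {idle}.
- case: eqP => [[-> ]|_ /idle//]; case: s {idle} => //= c s [<- ->].
  by case=> -> /foldr_Box_inj->.
- case: eqP => [[-> ]|_ /idle//]; case: s {idle} => //= d s [<- ->].
  case=> -> /(@foldr_Box_inj _ [:: b, c & s])<-.
  by exists (Trace y s a f).
- case: eqP => [[-> ]|_ /idle//]; case: s {idle} => //= d s [<- ->].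
  case=> -> /(@foldr_Box_inj _ (_ :: s))<-.
  by exists (Trace y s a f).
- case: eqP => [[-> ]|_ /idle//]; case: s {idle} => //= d s [<- ->].
  by case=> -> /foldr_Box_inj->.
(* With an empty spine the target itself is unfolded: the left premise leaves [f], too shallow to
   contain the target, so the new spine is [[:: a]]. *)
- case: eqP => [[-> ]|_ /idle//]; case: s {idle} => [|d s] /=.
    case=> -> ->; case: eqP => _ [-> fE].
      by case: (@foldr_Box_neq f (Star a) t).
    by move: fE => /(@foldr_Box_inj _ [:: a])<-.
  case=> <- ->; case: eqP => _ [->].
    by move/foldr_Box_inj->.
  by move/(@foldr_Box_inj _ [:: b, Star b & s])<-.
Qed.

Lemma search_global_trace G D :
  valid (G ⇒ D) -> global_trace_condition (search 0 (G ⇒ D)).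
Proof.
move=> validGD path dir [path0 pathS]; apply: NNPP => notrace.
pose S n := endsequent (path n).
have pathE n : path n = search n (S n).
  elim: n => [|n IH]; first by rewrite /S path0 endsequent_search.
  by rewrite /S pathS (subtree_search _ IH) endsequent_search.
have SE n : S n.+1 = premise (dir n).
  by rewrite /S pathS (subtree_search _ (pathE n)) endsequent_search.
have rootE n : root_rule (path n) = search_rule n (S n) by rewrite pathE.
have S_open n : ~ closed (S n).
  move=> closedS.
  (* Below a closed sequent all sequents would stay closed and lose size at each step, which cannot
     go on forever. *)
  suff shrink k : closed (S (k + n)) /\
      sequent_size (S (k + n)) + k <= sequent_size (S n).
    have [_] := shrink (sequent_size (S n)).+1.
    by rewrite addnS ltnNge leq_addl.
  elim: k => [|k [closedk lek]]; first by rewrite addn0.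
  have [_ _ _ [[_]|[/(_ closedk)//]]] := search_ruleP (k + n) (S (k + n)).
  rewrite -rootE => /(_ (dir (k + n)))[].
  rewrite -SE => closedSk ltk; split=> //.
  by rewrite addnS -addSn; apply: leq_trans lek; rewrite leq_add2r.
have ruleE n : root_rule (path n) = rule_for (schedule n) (S n).
  by rewrite rootE; have [_ _ _ [[/S_open]|[]]] := search_ruleP n (S n).
have SE_nth n :
    S n.+1 = nth (S n) (premises (rule_for (schedule n) (S n))) (dir n).
  by rewrite -ruleE SE /premise (tnth_nth (S n)).
apply: (@branch_not_valid S schedule (fun n => dir n)) => //.
- exact: schedule_fair.
- by move=> n; rewrite -ruleE.
(* This discharges [no_star_track]: the forbidden track is turned into the trace whose absence was
   assumed. *)
- move=> n p a f target badp prog.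
  set tr := track _ _ _ _ _ in badp prog.
  apply: notrace.
  (* The spines are only known to exist; choice makes them a function of the stage. *)
  have spine j := constructive_indefinite_description _ (proj2 (badp j)).
  pose tau j := Trace (tr j).1 (sval (spine j)) a f.
  have assert_tau j : assertion_of (tau j) = Lab (tr j).1 (tr j).2.
    by rewrite (svalP (spine j)).
  have follows : trace_follows dir n tau.
    move=> j; apply: (@trace_pair_descend (S (j + n))).
    - by rewrite ruleE; apply: rule_forP.
    - rewrite -/(assertion_of (tau j)) assert_tau.
      exact: (badp j).1.1.
    - rewrite -/(assertion_of (tau j.+1)) assert_tau -SE.
      exact: (badp j.+1).1.1.
    - rewrite -(svalP (spine j)) -(svalP (spine j.+1)) -!surjective_pairing.
      by rewrite /tr /= -ruleE.
  exists n, tau; split=> // m; have [j lemj [jE prin]] := prog m.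
  exists j => //; split=> //.
    by rewrite /is_principal assert_tau ruleE prin jE.
  by apply: (@foldr_Box_inj target); rewrite -(svalP (spine j)).
- by rewrite /S path0 endsequent_search.
Qed.

Theorem theorem2 (G D : {fset assertion}) (hvalid : valid (Sequent G D)) :
  exists t : tree, G3PDL_proof t (Sequent G D) /\ cut_free t.
Proof.
exists (search 0 (G ⇒ D)); split; last exact: cut_free_search.
split; first exact: endsequent_search.
- exact: derivation_search.
- exact: search_global_trace.
Qed.
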